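(* Let $\{a_n\}_{n\ge0}$ be a sequence of $p$-adic numbers with $v_p(a_n)=-r_n$, where $r_n\ge1$ for all $n\ge1$. Let $x_0,y_0\in\mathbb{Q}_p$, not both zero, and define $x_{n+1}=x_na_n+y_n$, $y_{n+1}=x_n$ for $n\ge0$. Put $\mu_n=\min\{v_p(x_na_n),v_p(y_n)\}$. If, for some $n\ge0$, $$\mu_n\le v_p(x_na_n+y_n)\le\mu_n+r_n,$$ then $v_p(x_ma_m)<v_p(y_m)$ for all $m\ge n+1$.
   Context: $p$ is a prime and $v_p$ is the $p$-adic valuation on $\mathbb{Q}_p$, with $v_p(0)=+\infty$. *)

(* Defs.v *)
From HB Require Import structures.
From mathcomp Require Import all_boot all_order all_algebra.
From mathcomp Require Import boolp constructive_ereal.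

Set Implicit Arguments.
Unset Strict Implicit.
Unset Printing Implicit Defensive.

Import Order.TTheory GRing.Theory Num.Theory.

(* Z_p is the inverse limit of the rings Z/p^n.  A residue modulo p^n is       *)
(* represented by its canonical representative in [0, p^n[, so that the single *)
(* condition f n.+1 %% p ^ n = f n says both that f n is reduced and that the  *)
(* family is compatible with the projections Z/p^(n+1) -> Z/p^n.               *)
Record padicInt (p : nat) (p_pr : prime p) := PadicInt {
  residue :> nat -> nat;
  _ : `[< forall n, residue n.+1 %% p ^ n = residue n >] }.

HB.instance Definition _ p p_pr := [isSub for @residue p p_pr].
HB.instance Definition _ p (p_pr : prime p) :=
  [Choice of padicInt p_pr by <:].

Section PadicInt.
Variables (p : nat) (p_pr : prime p).
Implicit Types x y z : padicInt p_pr.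

Local Notation Zp := (padicInt p_pr).

Let expp_gt0 n : 0 < p ^ n. Proof. by rewrite expn_gt0 prime_gt0. Qed.

Lemma residueS x n : x n.+1 %% p ^ n = x n.
Proof. by case: x => f /= /asboolP. Qed.

Lemma residue_mod x m n : m <= n -> x n %% p ^ m = x m.
Proof.
move=> /subnK <-; elim: (n - m) => [|k IHk].
  by rewrite -[in LHS]residueS modn_mod residueS.
by rewrite -IHk -[x (k + m)]residueS modn_dvdm ?dvdn_exp2l ?leq_addl.
Qed.

Lemma residue_small x n : x n %% p ^ n = x n.
Proof. exact: residue_mod. Qed.

Lemma padicIntP x y : (forall n, x n = y n) -> x = y.
Proof. by move=> xy; apply/val_inj/funext. Qed.

Definition reduce_subproof (f : nat -> nat) :
    (forall n, f n.+1 = f n %[mod p ^ n]) ->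
  `[< forall n, (f n.+1 %% p ^ n.+1) %% p ^ n = f n %% p ^ n >].
Proof. by move=> fP; apply/asboolP => n; rewrite modn_dvdm ?dvdn_exp2l. Qed.

Definition reduce (f : nat -> nat) fP : Zp :=
  @PadicInt p p_pr (fun n => f n %% p ^ n) (@reduce_subproof f fP).

Fact nat_subproof (m n : nat) : m = m %[mod p ^ n]. Proof. by []. Qed.

Fact add_subproof x y n : x n.+1 + y n.+1 = x n + y n %[mod p ^ n].
Proof. by rewrite -modnDm !residueS. Qed.

Fact mul_subproof x y n : x n.+1 * y n.+1 = x n * y n %[mod p ^ n].
Proof. by rewrite -modnMm !residueS. Qed.

Fact opp_subproof x n :
  p ^ n.+1 - x n.+1 = p ^ n - x n %[mod p ^ n].
Proof.
have le m : x m <= p ^ m by rewrite -residue_small ltnW ?ltn_mod.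
apply/eqP; rewrite -(eqn_modDr (x n.+1)) subnK // -modnDmr residueS subnK //.
by rewrite modnn expnS modnMl.
Qed.

Definition padicInt_nat m : Zp := reduce (nat_subproof m).
Definition padicInt_add x y : Zp := reduce (add_subproof x y).
Definition padicInt_opp x : Zp := reduce (opp_subproof x).
Definition padicInt_mul x y : Zp := reduce (mul_subproof x y).

Fact padicInt_addA : associative padicInt_add.
Proof.
by move=> x y z; apply: padicIntP => n /=; rewrite modnDmr modnDml addnA.
Qed.

Fact padicInt_addC : commutative padicInt_add.
Proof. by move=> x y; apply: padicIntP => n /=; rewrite addnC. Qed.

Fact padicInt_add0 : left_id (padicInt_nat 0) padicInt_add.
Proof.
by move=> x; apply: padicIntP => n /=; rewrite mod0n add0n residue_small.
Qed.

Fact padicInt_addN : left_inverse (padicInt_nat 0) padicInt_opp padicInt_add.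
Proof.
move=> x; apply: padicIntP => n /=; rewrite modnDml subnK ?modnn ?mod0n //.
by rewrite -residue_small ltnW ?ltn_mod.
Qed.

HB.instance Definition _ := GRing.isZmodule.Build Zp
  padicInt_addA padicInt_addC padicInt_add0 padicInt_addN.

Fact padicInt_mulA : associative padicInt_mul.
Proof.
by move=> x y z; apply: padicIntP => n /=; rewrite modnMmr modnMml mulnA.
Qed.

Fact padicInt_mulC : commutative padicInt_mul.
Proof. by move=> x y; apply: padicIntP => n /=; rewrite mulnC. Qed.

Fact padicInt_mul1 : left_id (padicInt_nat 1) padicInt_mul.
Proof.
by move=> x; apply: padicIntP => n /=; rewrite modnMml mul1n residue_small.
Qed.

Fact padicInt_mulDl : left_distributive padicInt_mul padicInt_add.
Proof.
by move=> x y z; apply: padicIntP => n /=; rewrite modnMml modnDm mulnDl.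
Qed.

Fact padicInt_1neq0 : padicInt_nat 1 != 0%R.
Proof.
apply/eqP => /(congr1 (fun x : Zp => x 1)) /=.
by rewrite expn1 mod0n modn_small ?prime_gt1.
Qed.

HB.instance Definition _ := GRing.Zmodule_isComNzRing.Build Zp
  padicInt_mulA padicInt_mulC padicInt_mul1 padicInt_mulDl padicInt_1neq0.

Lemma residue0 n : (0%R : Zp) n = 0. Proof. exact: mod0n. Qed.

Lemma residueM x y n : (x * y)%R n = (x n * y n) %% p ^ n. Proof. by []. Qed.

Lemma residueD x y n : (x + y)%R n = (x n + y n) %% p ^ n. Proof. by []. Qed.

Lemma residue_nat m n : (m%:R%R : Zp) n = m %% p ^ n.
Proof.
elim: m => [|m IHm]; first by rewrite residue0 mod0n.
by rewrite -addn1 natrD residueD IHm /= modnDm.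
Qed.

Definition padicInt_unit : pred Zp := fun x => `[< exists y, (y * x = 1)%R >].

Definition padicInt_inv x : Zp :=
  if pselect (exists y, (y * x = 1)%R) is left ex then sval (cid ex) else x.

Fact padicInt_mulVx : {in padicInt_unit, left_inverse 1%R padicInt_inv *%R}.
Proof.
move=> x /asboolP ux; rewrite /padicInt_inv; case: pselect => // ex.
by case: cid.
Qed.

Fact padicInt_unitP x y : (y * x = 1)%R -> padicInt_unit x.
Proof. by move=> yx1; apply/asboolP; exists y. Qed.

Fact padicInt_inv_out : {in [predC padicInt_unit], padicInt_inv =1 id}.
Proof. by move=> x /asboolP ux; rewrite /padicInt_inv; case: pselect. Qed.

HB.instance Definition _ := GRing.ComNzRing_hasMulInverse.Build Zp
  padicInt_mulVx padicInt_unitP padicInt_inv_out.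

(* For x != 0, the largest n such that x lies in p^n Z_p, i.e., such that the  *)
(* residue of x modulo p^n is 0; the value at 0 is irrelevant.                 *)
Definition padicInt_val x : nat :=
  if pselect (exists n, x n.+1 != 0) is left ex then ex_minn ex else 0.

Lemma padicInt_neq0 x : x != 0%R -> exists n, x n.+1 != 0.
Proof.
move=> x0; apply: contrapT => h; case/eqP: x0; apply: padicIntP => n.
rewrite residue0 -residueS; case: (eqVneq (x n.+1) 0) => [->|xn].
  exact: mod0n.
by case: h; exists n.
Qed.

Lemma padicInt_valE x n : x != 0%R -> (x n == 0) = (n <= padicInt_val x).
Proof.
move=> /padicInt_neq0 ex; rewrite /padicInt_val; case: pselect => // ex'.
case: ex_minnP => k xk kmin; case: leqP => [nk|kn].
  case: n nk => [|n nk]; first by rewrite -residue_small expn0 modn1.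
  by apply: contraTT nk => /kmin; rewrite -leqNgt.
by apply: contraNF xk => /eqP xn; rewrite -(residue_mod x kn) xn mod0n.
Qed.

Lemma padicInt_val_logn x n : padicInt_val x < n -> x != 0%R ->
  0 < x n /\ logn p (x n) = padicInt_val x.
Proof.
move=> ltn x0; have xn : 0 < x n by rewrite lt0n padicInt_valE // -ltnNge.
split=> //; have dvd m : m <= n -> (p ^ m %| x n) = (m <= padicInt_val x).
  by move=> mn; rewrite -padicInt_valE // /dvdn residue_mod.
apply/eqP; rewrite eqn_leq -[X in _ && X]pfactor_dvdn // dvd ?(ltnW ltn) //.
by rewrite leqnn andbT leqNgt -pfactor_dvdn // dvd // ltnn.
Qed.

Lemma padicInt_valM_neq0 x y : x != 0%R -> y != 0%R ->
  (x * y != 0)%R /\ padicInt_val (x * y)%R = padicInt_val x + padicInt_val y.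
Proof.
move=> x0 y0; set a := padicInt_val x; set b := padicInt_val y.
have [xn la] : 0 < x (a + b).+1 /\ logn p (x (a + b).+1) = a.
  by apply: padicInt_val_logn; rewrite // ltnS leq_addr.
have [yn lb] : 0 < y (a + b).+1 /\ logn p (y (a + b).+1) = b.
  by apply: padicInt_val_logn; rewrite // ltnS leq_addl.
have dvd m : m <= (a + b).+1 -> ((x * y)%R m == 0) = (m <= a + b).
  move=> mab; rewrite -(residue_mod (x * y)%R mab) residueM.
  rewrite modn_dvdm ?dvdn_exp2l // -[_ == 0]/(p ^ m %| _).
  by rewrite pfactor_dvdn ?muln_gt0 ?xn // lognM // la lb.
have xy0 : (x * y != 0)%R.
  by apply/eqP => xy0; have := dvd _ (leqnn _); rewrite xy0 residue0 eqxx ltnn.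
split=> //; apply/eqP; rewrite eqn_leq; apply/andP; split.
  rewrite leqNgt; apply/negP => lt.
  by have := dvd _ (leqnn _); rewrite padicInt_valE // lt ltnn.
by rewrite -padicInt_valE // dvd.
Qed.

Fact padicInt_integral x y : (x * y = 0)%R -> (x == 0%R) || (y == 0%R).
Proof.
move=> xy0; rewrite -[_ || _]negbK negb_or; apply/negP => /andP[x0 y0].
by have [] := padicInt_valM_neq0 x0 y0; rewrite xy0 eqxx.
Qed.

HB.instance Definition _ :=
  GRing.ComUnitRing_isIntegral.Build Zp padicInt_integral.

End PadicInt.

Definition padic (p : nat) (p_pr : prime p) : fieldType :=
  {fraction padicInt p_pr}.

Section Valuation.
Variables (p : nat) (p_pr : prime p).

Local Open Scope ring_scope.
Local Notation Zp := (padicInt p_pr).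
Local Notation Qp := (padic p_pr).
Local Notation "x %:F" := (@FracField.tofrac Zp x : Qp).

(* Computed on a chosen representative; vp_frac shows independence of it. *)
Definition vp (x : Qp) : \bar int :=
  if x == 0 then +oo%E
  else ((padicInt_val \n_(repr x))%:Z - (padicInt_val \d_(repr x))%:Z)%:E.

Lemma padic_numden (q : Qp) : q = (\n_(repr q))%:F / (\d_(repr q))%:F.
Proof.
have d0 : \d_(repr q) != 0 by exact: denom_ratioP.
have dF0 : (\d_(repr q))%:F != 0 by rewrite tofrac_eq0.
apply: (mulIf dF0); rewrite divfK // -[X in X * _](reprK q).
set u := repr q in d0 *; unlock FracField.tofrac.
rewrite !piE; apply/eqmodP => /=.
rewrite FracField.equivfE /FracField.mulf !numden_Ratio ?mulf_neq0 ?oner_neq0 //.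
by rewrite !mulr1 mulrC.
Qed.

Lemma padic_fracP (q : Qp) : exists x y, y != 0 /\ q = x%:F / y%:F.
Proof.
exists (\n_(repr q)), (\d_(repr q)); split; first exact: denom_ratioP.
exact: padic_numden.
Qed.

Lemma vp0 : vp 0 = +oo%E. Proof. by rewrite /vp eqxx. Qed.

Lemma vp_frac (x y : Zp) : x != 0 -> y != 0 ->
  vp (x%:F / y%:F) = ((padicInt_val x)%:Z - (padicInt_val y)%:Z)%:E.
Proof.
move=> x0 y0; rewrite /vp.
have q0 : x%:F / y%:F != 0 by rewrite mulf_neq0 ?invr_eq0 ?tofrac_eq0.
rewrite (negPf q0); congr (_%:E).
set q := x%:F / y%:F in q0 *.
have d0 : \d_(repr q) != 0 by exact: denom_ratioP.
have n0 : \n_(repr q) != 0.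
  by apply: contraNneq q0 => n0; rewrite (padic_numden q) n0 rmorph0 mul0r.
have /eqP : x%:F / y%:F = (\n_(repr q))%:F / (\d_(repr q))%:F.
  exact: padic_numden.
rewrite eqr_div ?tofrac_eq0 // -!rmorphM tofrac_eq => /eqP eq.
have [_] := padicInt_valM_neq0 x0 d0.
rewrite eq (padicInt_valM_neq0 n0 y0).2 => e.
apply/eqP; rewrite subr_eq addrAC eq_sym subr_eq -!PoszD eqz_nat.
by rewrite e.
Qed.

Lemma vp_nat (m : nat) : (0 < m)%N -> vp m%:R = ((logn p m)%:Z)%:E.
Proof.
move=> m0; set x : Zp := m%:R.
have xE n : (x n == 0%N) = (n <= logn p m)%N.
  by rewrite residue_nat -[_ == _]/(_ %| _)%N pfactor_dvdn.
have x0 : x != 0.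
  by apply/eqP => x0; have := xE (logn p m).+1; rewrite x0 residue0 eqxx ltnn.
have vx : padicInt_val x = logn p m.
  apply/eqP; rewrite eqn_leq -xE padicInt_valE // leqnn /=.
  by rewrite -padicInt_valE // xE.
have v1 : padicInt_val (1 : Zp) = 0%N.
  apply/eqP; rewrite -leqn0 leqNgt -padicInt_valE ?oner_neq0 //=.
  by rewrite expn1 modn_small ?prime_gt1.
have -> : m%:R = x%:F / 1%:F by rewrite rmorph1 divr1 /x rmorph_nat.
by rewrite vp_frac ?oner_neq0 // vx v1 subr0.
Qed.

Lemma vpM (q r : Qp) : vp (q * r) = (vp q + vp r)%E.
Proof.
have [->|q0] := eqVneq q 0; first by rewrite mul0r vp0; rewrite /vp; case: ifP.
have [->|r0] := eqVneq r 0; first by rewrite mulr0 vp0; rewrite /vp; case: ifP.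
have [x [y [y0 qE]]] := padic_fracP q.
have [z [t [t0 rE]]] := padic_fracP r.
have x0 : x != 0 by apply: contraNneq q0 => x0; rewrite qE x0 rmorph0 mul0r.
have z0 : z != 0 by apply: contraNneq r0 => z0; rewrite rE z0 rmorph0 mul0r.
have [xz0 vxz] := padicInt_valM_neq0 x0 z0.
have [yt0 vyt] := padicInt_valM_neq0 y0 t0.
rewrite qE rE mulf_div -!rmorphM !vp_frac // vxz vyt -EFinD !PoszD.
by congr (_%:E); rewrite opprD addrACA.
Qed.

Lemma vpD (q r : Qp) : (Order.min (vp q) (vp r) <= vp (q + r))%E.
Proof.
have [->|q0] := eqVneq q 0; first by rewrite add0r ge_min lexx orbT.
have [->|r0] := eqVneq r 0; first by rewrite addr0 ge_min lexx.
have [->|qr0] := eqVneq (q + r) 0; first by rewrite vp0 leey.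
have [x [y [y0 qE]]] := padic_fracP q.
have [z [t [t0 rE]]] := padic_fracP r.
have yt0 : y * t != 0 by rewrite mulf_neq0.
have qE' : q = (x * t)%:F / (y * t)%:F.
  by rewrite qE !rmorphM -mulf_div divff ?tofrac_eq0 // mulr1.
have rE' : r = (z * y)%:F / (y * t)%:F.
  by rewrite rE [y * t]mulrC !rmorphM -mulf_div divff ?tofrac_eq0 // mulr1.
move: (x * t) (z * y) (y * t) yt0 qE' rE' => a b c c0 qE' rE'.
have sE : q + r = (a + b)%:F / c%:F by rewrite qE' rE' rmorphD mulrDl.
have a0 : a != 0 by apply: contraNneq q0 => a0; rewrite qE' a0 rmorph0 mul0r.
have b0 : b != 0 by apply: contraNneq r0 => b0; rewrite rE' b0 rmorph0 mul0r.
have s0 : a + b != 0 by apply: contraNneq qr0 => s0; rewrite sE s0 rmorph0 mul0r.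
rewrite sE {1}qE' {1}rE' !vp_frac // ge_min !lee_fin !lerD2r !lez_nat.
wlog ab : a b a0 b0 s0 {qE' rE' sE} / (padicInt_val a <= padicInt_val b)%N.
  move=> h; case/orP: (leq_total (padicInt_val a) (padicInt_val b)) => le.
    exact: h.
  by rewrite orbC addrC; apply: h; rewrite // addrC.
apply/orP; left; rewrite -padicInt_valE // residueD.
have /eqP -> : a (padicInt_val a) == 0%N by rewrite padicInt_valE.
have /eqP -> : b (padicInt_val a) == 0%N by rewrite padicInt_valE.
by rewrite mod0n.
Qed.

End Valuation.

(* Main.v *)
(* Since mu_n <= v(x_n) - r_n, the upper bound v(x_{n+1}) <= mu_n + r_n gives
   v(x_{n+1}) <= v(x_n), hence v(x_{n+1} a_{n+1}) < v(x_n) = v(y_{n+1}) because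
   r_{n+1} >= 1.  Conversely, strict dominance v(x_m a_m) < v(y_m) forces
   v(x_m a_m + y_m) = mu_m <= mu_m + r_m, which is the same upper bound at m, so
   dominance propagates. *)
Require Import Defs.
From mathcomp Require Import all_boot all_order all_algebra.
From mathcomp Require Import constructive_ereal.
From mathcomp Require Import zify.
Import Order.TTheory GRing.Theory Num.Theory.
Local Open Scope ring_scope.

Lemma vp_fin {p : nat} {p_pr : prime p} {q : padic p_pr} :
  q != 0 -> exists k : int, vp q = k%:E.
Proof. by rewrite /vp => /negPf ->; eexists. Qed.

(** Since (-1)(-1) = 1, twice the integer v(-1) equals v(1) = 0, and multiplicativity does the
    rest. *)
Lemma vpN {p : nat} {p_pr : prime p} (q : padic p_pr) : vp (- q) = vp q.
Proof.
have [k vk] : exists k : int, vp (-1 : padic p_pr) = k%:E.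
  by apply: vp_fin; rewrite oppr_eq0 oner_neq0.
have := vpM (-1 : padic p_pr) (-1).
rewrite mulrNN mulr1 (@vp_nat _ p_pr 1) // logn1 vk -EFinD => -[kk].
have k0 : k = 0 by lia.
by rewrite -mulN1r vpM vk k0 add0e.
Qed.

(** Apply the ultrametric inequality to q = (q + s) - s: strictness rules out v(s) as the smaller
    term. *)
Lemma vpD_le {p : nat} {p_pr : prime p} (q s : padic p_pr) :
  (vp q < vp s)%E -> (vp (q + s) <= vp q)%E.
Proof.
move=> qs; have := vpD (q + s) (- s).
by rewrite addrK vpN ge_min [X in _ || X]leNgt qs orbF.
Qed.

(** One step of the recurrence, with [a], [r] at the current index and [b], [s] at the next. No sign
    is imposed on [r], so that index 0 is covered. *)
Lemma band_dominates {p : nat} {p_pr : prime p} (x y a b : padic p_pr)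
    (r s : \bar int) :
  vp a = (- r)%E -> vp b = (- s)%E -> (1%:E <= s)%E -> ~ (x = 0 /\ y = 0) ->
  (vp (x * a + y) <= Order.min (vp (x * a)) (vp y) + r)%E ->
  (vp ((x * a + y) * b) < vp x)%E.
Proof.
move=> va vb s1 xy0 hz.
have b0 : b != 0.
  by apply/eqP => b0; move: vb s1; rewrite b0 vp0; case: s.
have [l vl] := vp_fin b0.
have sE : s = (- l)%:E by rewrite -[s]oppeK -vb vl.
(* If a = 0 then r = -oo. By the convention +oo + -oo = -oo the upper bound is -oo whatever the
   minimum is, and no valuation takes that value. *)
have [a0|a0] := eqVneq a 0.
  move: va hz; rewrite a0 vp0; case: r => // _.
  by rewrite addeNy leeNy_eq /vp; case: ifP.
have [k vk] := vp_fin a0.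
have rE : r = (- k)%:E by rewrite -[r]oppeK -va vk.
(* If the sum vanished, the bound would read +oo <= min + r with r finite, forcing xa = y = 0 and
   hence x = y = 0. *)
have z0 : x * a + y != 0.
  apply/eqP => z0; apply: xy0; move: hz; rewrite z0 vp0 rE.
  have [xa0|/vp_fin[i ->]] := eqVneq (x * a) 0.
    have [y0 _|/vp_fin[j ->]] := eqVneq y 0; last by rewrite xa0 vp0.
    by move/eqP: xa0; rewrite mulf_eq0 (negPf a0) orbF => /eqP.
  have [->|/vp_fin[j ->]] := eqVneq y 0; first by rewrite vp0 miney.
  by rewrite -EFin_min.
have [w vw] := vp_fin z0.
rewrite vpM vw vl -EFinD.
have [->|/vp_fin[i vi]] := eqVneq x 0; first by rewrite vp0 ltry.
have /(leeD2r r)/(le_trans hz) : (Order.min (vp (x * a)) (vp y) <= vp (x * a))%E.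
  by rewrite ge_min lexx.
rewrite vpM vi vw vk rE -!EFinD lee_fin lte_fin.
move: s1; rewrite sE lee_fin; lia.
Qed.

Theorem lemma24 (p : nat) (p_pr : prime p)
    (a : nat -> padic p_pr) (r : nat -> \bar int)
    (va : forall n, vp (a n) = (- r n)%E)
    (r_ge1 : forall n, (1 <= n)%N -> (1%:E <= r n)%E)
    (x y : nat -> padic p_pr)
    (xy0 : ~ (x 0%N = 0 /\ y 0%N = 0))
    (xS : forall n, x n.+1 = x n * a n + y n)
    (yS : forall n, y n.+1 = x n)
    (mu : nat -> \bar int)
    (muE : forall n, mu n = Order.min (vp (x n * a n)) (vp (y n)))
    (n : nat)
    (h : (mu n <= vp (x n * a n + y n) <= mu n + r n)%E) :
  forall m, (n.+1 <= m)%N -> (vp (x m * a m) < vp (y m))%E.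
Proof.
have xyn0 k : ~ (x k = 0 /\ y k = 0).
  elim: k => // k IHk; rewrite xS yS => -[xk1 xk]; apply: IHk.
  by move: xk1; rewrite xk mul0r add0r.
have step k : (vp (x k * a k + y k) <= mu k + r k)%E ->
    (vp (x k.+1 * a k.+1) < vp (y k.+1))%E.
  rewrite muE yS xS => hk.
  by apply: band_dominates hk => //; rewrite ?va ?r_ge1.
elim=> // m IHm; rewrite ltnS leq_eqVlt => /predU1P[<-|nm].
  by apply: step; case/andP: h.
have dom := IHm nm; apply: step; rewrite muE (min_idPl (ltW dom)).
apply: le_trans (vpD_le _ _ dom) _; rewrite leeDl //.
(* Here m > n >= 0, so m >= 1 and r_m >= 1 is available. *)
by apply: le_trans (r_ge1 m _); rewrite ?lee_fin // (leq_trans _ nm).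
Qed.
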